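(* Let $A$ be a ranked real matrix. Then, by applying finitely many elementary row operations and column swaps, $A$ can be transformed into a matrix in reduced row echelon form.
   Context: The setting is Bishop-style constructive mathematics (intuitionistic logic; the law of excluded middle is not available). For real numbers, $x\neq y$ means that $x$ and $y$ are apart: there is a rational $q>0$ with $|x-y|>q$. For vectors in $\mathbb{R}^n$, $\mathbf{x}\neq\mathbf{y}$ means that some coordinate of $\mathbf{x}$ is apart from the corresponding coordinate of $\mathbf{y}$. Vectors $\mathbf{x}_1,\dots,\mathbf{x}_m$ are independent if for all $\beta\in\mathbb{R}^m$, $\beta\neq\mathbf{0}$ implies $\sum_i\beta_i\mathbf{x}_i\neq\mathbf{0}$. A basis of a vector space $V$ is a finite independent family whose span is $V$; the dimension of $V$, when a basis exists, is the number of elements of a basis (any two bases have the same number of elements). A matrix $A$ is ranked, with $\operatorname{rank}A=r$, if the span $\operatorname{col}A$ of its columns has dimension $r$ (rank $0$ means $\operatorname{col}A=\{\mathbf{0}\}$). Elementary row operations: (1) exchanging two rows; (2) multiplying a row by a number apart from $0$; (3) adding a multiple of a row to another row. A matrix is in row echelon form if: (1) every row either consists of zero or more $0$'s followed by an entry apart from $0$ (and then arbitrary entries), or is the zero row; (2) if a row has more initial zeroes than another row, it is below the row with fewer initial zeroes; (3) two rows can have the same number of initial zeroes only if both are identically $\mathbf{0}$. It is in reduced row echelon form if moreover the first entry apart from $0$ in each nonzero row is $1$, and all entries above such an initial $1$ are $0$. *)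

(* Defs.v *)
From Stdlib Require Import QArith ConstructiveReals ConstructiveAbs.
From mathcomp Require Import all_boot.
From mathcomp Require Import matrix.

Set Implicit Arguments.
Unset Strict Implicit.
Unset Printing Implicit Defensive.

Local Open Scope ConstructiveReals.

(* The setting is Bishop-style constructive mathematics, so the reals are an
   arbitrary implementation of the standard library's interface of constructive
   reals, a setoid with equality [x == y] and apartness [x ≶ y], and the logic
   is the Curry-Howard one in [Type]: "exists" is a sigma type and "or" a sum
   type. Both carry witnesses, as in the BHK reading. *)

Lemma apart_rational (R : ConstructiveReals) (x y : CRcarrier R) :
  ((x ≶ y) -> {q : Q & ((0 < q)%Q * (CR_of_Q R q < CRabs R (x - y)))%type})
  * ({q : Q & ((0 < q)%Q * (CR_of_Q R q < CRabs R (x - y)))%type} -> (x ≶ y)).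
Proof.
split.
- move=> xy.
  have pos : 0 < CRabs R (x - y).
    case: xy => lt_xy.
    + rewrite CRabs_minus_sym; apply: (CRlt_le_trans _ (y - x)).
        apply: (CRplus_lt_reg_l R x).
        by rewrite CRplus_0_r /CRminus (CRplus_comm y) -CRplus_assoc
                   CRplus_opp_r CRplus_0_l.
      exact: CRle_abs.
    + apply: (CRlt_le_trans _ (x - y)); last exact: CRle_abs.
      apply: (CRplus_lt_reg_l R y).
      by rewrite CRplus_0_r /CRminus (CRplus_comm x) -CRplus_assoc
                 CRplus_opp_r CRplus_0_l.
  have [q [q0 qxy]] := CR_Q_dense R _ _ pos.
  by exists q; split=> //; apply: lt_CR_of_Q q0.
- case=> q [q0 qxy].
  have pos : 0 < CRabs R (x - y).
    by apply: CRlt_trans qxy; apply: CR_of_Q_lt.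
  have e z : y + (z - y) == z.
    rewrite /CRminus (CRplus_comm z) -CRplus_assoc CRplus_opp_r CRplus_0_l.
    exact: CReq_refl.
  case: (CRabs_appart_0 _ pos) => h; [left | right].
  + move: (CRplus_lt_compat_l R y _ _ h).
    by rewrite e CRplus_0_r.
  + move: (CRplus_lt_compat_l R y _ _ h).
    by rewrite e CRplus_0_r.
Qed.

Section LinearAlgebra.
Variable R : ConstructiveReals.
Notation real := (CRcarrier R).

Definition vec_eq n (v w : 'cV[real]_n) : Prop :=
  forall i, v i ord0 == w i ord0.

Definition vec_apart n (v w : 'cV[real]_n) : Type :=
  {i : 'I_n & v i ord0 ≶ w i ord0}.

Definition vec0 n : 'cV[real]_n := const_mx 0.

Definition lin_comb n k (x : 'I_k -> 'cV[real]_n) (b : 'cV[real]_k) :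
    'cV[real]_n :=
  \col_i \big[@CRplus R / 0]_(j < k) (b j ord0 * x j i ord0).

Definition independent n k (x : 'I_k -> 'cV[real]_n) : Type :=
  forall b : 'cV[real]_k,
    vec_apart b (vec0 k) -> vec_apart (lin_comb x b) (vec0 n).

Definition span n k (x : 'I_k -> 'cV[real]_n) (v : 'cV[real]_n) : Type :=
  {b : 'cV[real]_k & vec_eq v (lin_comb x b)}.

Definition is_basis n (V : 'cV[real]_n -> Type) k (x : 'I_k -> 'cV[real]_n) :
    Type :=
  (independent x *
   (forall v, (span x v -> V v) * (V v -> span x v)))%type.

Definition has_dim n (V : 'cV[real]_n -> Type) (k : nat) : Type :=
  {x : 'I_k -> 'cV[real]_n & is_basis V x}.

Definition col_space m n (A : 'M[real]_(m, n)) : 'cV[real]_m -> Type :=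
  span (fun j => col j A).

Definition has_rank m n (A : 'M[real]_(m, n)) (r : nat) : Type :=
  has_dim (col_space A) r.

Definition ranked m n (A : 'M[real]_(m, n)) : Type := {r : nat & has_rank A r}.

Definition scale_row m n (i : 'I_m) (c : real) (A : 'M[real]_(m, n)) :
    'M[real]_(m, n) :=
  \matrix_(k, l) if (k == i)%B then c * A k l else A k l.

(* Adds [c] times row [i'] to row [i]. *)
Definition add_row m n (i i' : 'I_m) (c : real) (A : 'M[real]_(m, n)) :
    'M[real]_(m, n) :=
  \matrix_(k, l) if (k == i)%B then A k l + c * A i' l else A k l.

Inductive operation m n (A : 'M[real]_(m, n)) : 'M[real]_(m, n) -> Type :=
| RowSwap (i i' : 'I_m) : operation A (xrow i i' A)
| RowScale (i : 'I_m) (c : real) : c ≶ 0 -> operation A (scale_row i c A)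
| RowAdd (i i' : 'I_m) (c : real) :
    (i != i')%B -> operation A (add_row i i' c A)
| ColSwap (j j' : 'I_n) : operation A (xcol j j' A).

Inductive transforms m n (A : 'M[real]_(m, n)) : 'M[real]_(m, n) -> Type :=
| TransformsRefl : transforms A A
| TransformsStep B C : transforms A B -> operation B C -> transforms A C.

Definition zero_row m n (A : 'M[real]_(m, n)) (i : 'I_m) : Prop :=
  forall j, A i j == 0.

Definition leading_at m n (A : 'M[real]_(m, n)) (i : 'I_m) (j : 'I_n) : Type :=
  ((forall l : 'I_n, (l < j)%N -> A i l == 0) * (A i j ≶ 0))%type.

(* A zero row of length [n] has [n] initial zeroes. *)
Definition initial_zeroes m n (A : 'M[real]_(m, n)) (i : 'I_m) (k : nat) :
    Type :=
  ({j : 'I_n & ((k = j :> nat) * leading_at A i j)%type}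
   + ((k = n) * zero_row A i))%type.

Record row_echelon m n (A : 'M[real]_(m, n)) : Type := RowEchelon {
  row_echelon_rows : forall i, ({j : 'I_n & leading_at A i j} + zero_row A i)%type;
  row_echelon_below : forall i i' k k',
    initial_zeroes A i k -> initial_zeroes A i' k' -> (k' < k)%N -> (i' < i)%N;
  row_echelon_ties : forall i i' k, (i != i')%B ->
    initial_zeroes A i k -> initial_zeroes A i' k ->
    zero_row A i /\ zero_row A i'
}.

Record reduced_row_echelon m n (A : 'M[real]_(m, n)) : Type :=
  ReducedRowEchelon {
  reduced_row_echelon_ref : row_echelon A;
  reduced_row_echelon_one : forall i j, leading_at A i j -> A i j == 1;
  reduced_row_echelon_above : forall i j, leading_at A i j ->
    forall i' : 'I_m, (i' < i)%N -> A i' j == 0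
}.

End LinearAlgebra.

(* Main.v *)
Require Import Defs.
From Stdlib Require Import ConstructiveReals.
From Stdlib Require Import Setoid Ring.
From mathcomp Require Import all_boot.
From mathcomp Require Import matrix.
From mathcomp Require Import perm.

(** Gauss-Jordan elimination needs, at each stage, either a pivot that is apart
from zero or the knowledge that the remaining entries vanish. Constructively
this cannot be decided by inspecting the entries: both kinds of information
have to be extracted from the rank. A basis of the column space of [A] is the
same thing as an m x r matrix [X] with independent columns such that
[A = X Y] and [X = A Z] for some [Y] and [Z] ([has_rank_column_basis]), and
these relations survive any row operation carried out on [A] and [X] together.

The reduction is done in two rounds. The first round only uses row operations
and reduces [X], not [A]. If the first [k < r] columns of [X] are already the
unit vectors, then column [k] minus its combination of those unit vectors is
apart from zero by independence, so column [k] has an entry apart from zero in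
some row [i >= k] ([independent_pivot]); this gives a pivot, and also shows
[k < m]. At the end [X] is the identity on top of zero ([reduce_basis]). Then
[A = X Y] shows that the rows of [A] from [r] on vanish
([unit_basis_zero_rows]), and [X = A Z] that [A] maps onto the vectors
supported on the first [r] coordinates ([unit_basis_onto]).

The second round reduces [A] itself. Let its first [k < r] columns be unit
vectors. As the unit vector number [k] is of the form [A v], row [k] has an
entry apart from zero, necessarily in a column [l >= k]
([onto_first_pivot_entry]). A column swap brings it to the diagonal, and
pivoting there affects neither the zero rows nor the surjectivity. After [r]
steps the matrix is [[I, D], [0, 0]] with an identity block of size [r]
([reduce_rows]), which is in reduced row echelon form ([block_reduced]). *)

Set Implicit Arguments.
Unset Strict Implicit.
Unset Printing Implicit Defensive.

Local Open Scope ConstructiveReals.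

(** * Apartness and finite sums *)

Notation "\sum_ ( i < n ) F" := (\big[@CRplus _ / 0]_(i < n) F)
  : ConstructiveReals.

#[local] Hint Resolve CReq_refl : core.

Section Reals.
Variable R : ConstructiveReals.
Notation real := (CRcarrier R).
Implicit Types x y z : real.

Lemma CR_Setoid_Theory : Setoid_Theory real (CReq R).
Proof. split; [exact: CReq_refl | exact: CReq_sym | exact: CReq_trans]. Qed.

Add Ring CR_ring : (CRisRing R) (setoid CR_Setoid_Theory (CRisRingExt R)).

Lemma apart_eq x y : x == y -> x ≶ 0 -> y ≶ 0.
Proof. by move=> e; rewrite e. Qed.

Lemma apart_zero_absurd x : x == 0 -> x ≶ 0 -> False.
Proof. by move=> [? ?] []. Qed.

Lemma apart10 : (1 : real) ≶ 0.
Proof. by right; exact: CRzero_lt_one. Qed.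

(** A positive product has factors apart from zero; the negative case reduces to
it by changing the sign of [y]. *)
Lemma apart_mul_l x y : x * y ≶ 0 -> x ≶ 0.
Proof.
have pos z : 0 < x * z -> x ≶ 0.
  by move=> /CRmult_pos_appart_zero [] ?; [right | left].
case=> [neg | ]; last exact: pos.
apply: (pos (- y)); apply: CRopp_lt_cancel.
have -> : - (x * - y) == x * y by ring.
by rewrite CRopp_0.
Qed.

Lemma apart_mul_r x y : x * y ≶ 0 -> y ≶ 0.
Proof. by rewrite CRmult_comm; apply: apart_mul_l. Qed.

Lemma apart_mul x y : x ≶ 0 -> y ≶ 0 -> x * y ≶ 0.
Proof.
move=> x0 y0; apply: (@apart_mul_l _ (CRinv R x x0 * CRinv R y y0)).
rewrite CRmult_comm.
have -> : CRinv R x x0 * CRinv R y y0 * (x * y) ==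
  (CRinv R x x0 * x) * (CRinv R y y0 * y) by ring.
by rewrite !CRinv_l CRmult_1_l; exact: apart10.
Qed.

Lemma apart_inv x (x0 : x ≶ 0) : CRinv R x x0 ≶ 0.
Proof. by apply: (@apart_mul_l _ x); rewrite CRinv_l; exact: apart10. Qed.

(** Cotransitivity of the order: [x] lies above [0] or below [x + y], and
likewise with the order reversed. *)
Lemma apart_add x y : x + y ≶ 0 -> (x ≶ 0) + (y ≶ 0).
Proof.
have [_ cotrans] := CRltLinear R.
case=> h.
- case: (cotrans _ x _ h) => h'; last by left; left.
  right; left; apply: (CRplus_lt_reg_l R x).
  by rewrite CRplus_0_r.
- case: (cotrans _ x _ h) => h'; first by left; right.
  right; right; apply: (CRplus_lt_reg_l R x).
  by rewrite CRplus_0_r.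
Qed.

Lemma apart_add_mul x c y : x ≶ 0 -> (x + c * y ≶ 0) + (y ≶ 0).
Proof.
move=> x0; have : (x + c * y) + - c * y ≶ 0 by apply: apart_eq x0; ring.
by case/apart_add => [? | /apart_mul_r]; [left | right].
Qed.

Lemma sum_eq n (F G : 'I_n -> real) :
  (forall i, F i == G i) -> \sum_(i < n) F i == \sum_(i < n) G i.
Proof.
move=> FG; apply: (big_rec2 (fun x y => x == y)) => [|i x y _ e] //.
by rewrite e FG.
Qed.

Lemma sum_add n (F G : 'I_n -> real) :
  \sum_(i < n) (F i + G i) == \sum_(i < n) F i + \sum_(i < n) G i.
Proof.
apply: (big_rec3 (fun x y z => z == x + y)) => [|i x y z _ e]; first by ring.
rewrite e; ring.
Qed.

Lemma sum_mul_l n x (F : 'I_n -> real) :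
  \sum_(i < n) (x * F i) == x * \sum_(i < n) F i.
Proof.
apply: (big_rec2 (fun y z => z == x * y)) => [|i y z _ e]; first by ring.
rewrite e; ring.
Qed.

Lemma sum_mul_r n x (F : 'I_n -> real) :
  \sum_(i < n) (F i * x) == (\sum_(i < n) F i) * x.
Proof.
rewrite CRmult_comm -sum_mul_l.
by apply: sum_eq => i; rewrite CRmult_comm.
Qed.

Lemma sum_zero n (F : 'I_n -> real) :
  (forall i, F i == 0) -> \sum_(i < n) F i == 0.
Proof.
move=> F0; apply: (big_rec (fun x => x == 0)) => [|i x _ e] //.
by rewrite e F0 CRplus_0_l.
Qed.

Lemma sum_exchange m n (F : 'I_m -> 'I_n -> real) :
  \sum_(i < m) \sum_(j < n) F i j == \sum_(j < n) \sum_(i < m) F i j.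
Proof.
have gen (s : seq 'I_m) :
    \big[@CRplus R / 0]_(i <- s) \sum_(j < n) F i j ==
    \sum_(j < n) \big[@CRplus R / 0]_(i <- s) F i j.
  elim: s => [|i s IH].
    by rewrite big_nil sum_zero // => j; rewrite big_nil.
  rewrite big_cons IH -sum_add.
  by apply: sum_eq => j; rewrite big_cons.
exact: gen.
Qed.

Lemma sum_only n (F : 'I_n -> real) (a : 'I_n) :
  (forall i, (i != a)%B -> F i == 0) -> \sum_(i < n) F i == F a.
Proof.
move=> F0.
suff in_seq (s : seq 'I_n) : uniq s ->
    \big[@CRplus R / 0]_(i <- s) F i == if a \in s then F a else 0.
  by rewrite (in_seq _ (index_enum_uniq _)) mem_index_enum.
elim: s => [|b s IH] /=; first by rewrite big_nil.
case/andP=> bs us; rewrite big_cons (IH us) inE.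
case: (eqVneq a b) => [e | ab].
  by subst b; rewrite (negbTE bs) /= CRplus_0_r.
rewrite /= F0; last by rewrite eq_sym.
by rewrite CRplus_0_l.
Qed.

(** The source of all pivots. By cotransitivity, a finite sum apart from zero
singles out one of its terms. *)
Lemma sum_apart n (F : 'I_n -> real) :
  \sum_(i < n) F i ≶ 0 -> {i : 'I_n & F i ≶ 0}.
Proof.
apply: (big_rec (fun x => x ≶ 0 -> {i : 'I_n & F i ≶ 0})) => [|i x _ IH].
  by move=> h; case: (apart_zero_absurd _ h).
by case/apart_add=> // ?; exists i.
Qed.

(** As addition of reals is associative and commutative only up to [==], the
proof goes by exchanging adjacent blocks of the index sequence. *)
Lemma sum_perm n (F : 'I_n -> real) (s : 'S_n) :
  \sum_(i < n) F (s i) == \sum_(i < n) F i.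
Proof.
rewrite -(big_map s predT F).
have ps : perm_eq (index_enum 'I_n) [seq s i | i <- index_enum 'I_n].
  apply: uniq_perm; first exact: index_enum_uniq.
    by rewrite (map_inj_uniq perm_inj) index_enum_uniq.
  by move=> i; rewrite mem_index_enum -(permKV s i) map_f ?mem_index_enum.
apply: (@catCA_perm_ind _ (fun l => \big[@CRplus R / 0]_(i <- l) F i ==
  \sum_(i < n) F i) _ _ _ ps) => // l1 l2 l3.
have cat2 (l l' : seq 'I_n) : \big[@CRplus R / 0]_(i <- l ++ l') F i ==
    \big[@CRplus R / 0]_(i <- l) F i + \big[@CRplus R / 0]_(i <- l') F i.
  elim: l => [|i l IH] /=; first by rewrite big_nil CRplus_0_l.
  by rewrite !big_cons IH CRplus_assoc.
move <-; rewrite !cat2; ring.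
Qed.

(** * Matrices up to equality of reals, and pivoting *)

Definition mat_eq m n (A B : 'M[real]_(m, n)) : Prop :=
  forall i j, A i j == B i j.
Local Notation "A =m B" := (mat_eq A B) (at level 70).

Definition mat_mul m n p (A : 'M[real]_(m, n)) (B : 'M[real]_(n, p)) :
    'M[real]_(m, p) :=
  \matrix_(i, j) \sum_(k < n) (A i k * B k j).
Local Notation "A ⋅ B" := (mat_mul A B) (at level 40, left associativity).

Lemma mat_mul_eq m n p (A A' : 'M[real]_(m, n)) (B : 'M[real]_(n, p)) :
  A =m A' -> A ⋅ B =m A' ⋅ B.
Proof. by move=> e i j; rewrite !mxE; apply: sum_eq => k; rewrite (e i k). Qed.

Lemma mat_mul_assoc m n p q (A : 'M[real]_(m, n)) (B : 'M[real]_(n, p))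
    (C : 'M[real]_(p, q)) :
  A ⋅ B ⋅ C =m A ⋅ (B ⋅ C).
Proof.
move=> i j; rewrite !mxE.
transitivity (\sum_(k < p) \sum_(l < n) (A i l * (B l k * C k j))).
  apply: sum_eq => k; rewrite !mxE -sum_mul_r.
  by apply: sum_eq => l; rewrite CRmult_assoc.
rewrite sum_exchange; apply: sum_eq => l.
by rewrite !mxE sum_mul_l.
Qed.

Definition kronecker (i j : nat) : real := if (i == j)%B then 1 else 0.

(** All row operations other than swaps that a Gauss-Jordan step performs with
pivot row [k], for arbitrary multipliers [c]. Treating them as one linear
transformation lets its effect on products, independence and surjectivity be
studied once. *)
Definition pivot m n (k : 'I_m) (c : 'I_m -> real) (A : 'M[real]_(m, n)) :
    'M[real]_(m, n) :=
  \matrix_(i, j) if (i == k)%B then c k * A k j else A i j + c i * A k j.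

Lemma transforms_trans m n (A B C : 'M[real]_(m, n)) :
  transforms A B -> transforms B C -> transforms A C.
Proof. by move=> AB; elim=> // B' C' _ IH op; exact: TransformsStep IH op. Qed.

Lemma transforms_op m n (A B : 'M[real]_(m, n)) :
  operation A B -> transforms A B.
Proof. exact: TransformsStep (TransformsRefl A). Qed.

(** The intermediate matrices of the next proof: [pivot k c A] with row [k] still
unscaled and only the rows in [s] processed. *)
Definition add_row_to m n (s : seq 'I_m) (k : 'I_m) (c : 'I_m -> real)
    (A : 'M[real]_(m, n)) : 'M[real]_(m, n) :=
  \matrix_(i, j) if (i != k)%B && (i \in s) then A i j + c i * A k j else A i j.

Lemma transforms_pivot m n (k : 'I_m) c (A : 'M[real]_(m, n)) :
  c k ≶ 0 -> transforms A (pivot k c A).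
Proof.
move=> ck0.
pose part s := add_row_to s k c A.
have part_s s : uniq s -> transforms A (part s).
  elim: s => [_ | a s IH /= /andP [as_ us]].
    have -> : part [::] = A by apply/matrixP=> i j; rewrite mxE in_nil andbF.
    exact: TransformsRefl.
  case: (eqVneq a k) => [ak | ak].
    have -> : part (a :: s) = part s; last exact: IH.
    apply/matrixP=> i j; rewrite !mxE inE ak.
    by case: (eqVneq i k).
  apply: (TransformsStep (IH us)).
  have -> : part (a :: s) = add_row a k (c a) (part s).
    apply/matrixP=> i j; rewrite !mxE inE eqxx /=.
    case: (eqVneq i a) => [-> | ia] //=.
    by rewrite ak (negbTE as_).
  exact: RowAdd.
apply: (TransformsStep (part_s _ (enum_uniq 'I_m))).
have -> : pivot k c A = scale_row k (c k) (part (enum 'I_m)).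
  apply/matrixP=> i j; rewrite !mxE.
  by case: (eqVneq i k) => [-> | _]; rewrite ?eqxx // mem_enum.
exact: RowScale.
Qed.

Lemma pivot_eq m n k c (A B : 'M[real]_(m, n)) :
  A =m B -> pivot k c A =m pivot k c B.
Proof.
by move=> e i j; rewrite !mxE; case: eqP => _; rewrite (e k j) ?(e i j).
Qed.

Lemma pivot_mul m n p k c (A : 'M[real]_(m, n)) (B : 'M[real]_(n, p)) :
  pivot k c A ⋅ B =m pivot k c (A ⋅ B).
Proof.
move=> i j; rewrite !mxE; case: (eqVneq i k) => [-> | ik].
  rewrite -sum_mul_l; apply: sum_eq => l.
  rewrite mxE eqxx; ring.
rewrite -sum_mul_l -sum_add; apply: sum_eq => l.
rewrite mxE (negbTE ik); ring.
Qed.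

Lemma xrow_mul m n p i1 i2 (A : 'M[real]_(m, n)) (B : 'M[real]_(n, p)) :
  xrow i1 i2 A ⋅ B =m xrow i1 i2 (A ⋅ B).
Proof. by move=> i j; rewrite !mxE; apply: sum_eq => l; rewrite mxE. Qed.

Lemma vec0E m (i : 'I_m) : vec0 R m i ord0 = 0.
Proof. by rewrite mxE. Qed.

(** A pivoting with [c k] apart from [0] is invertible, so it cannot send a vector
apart from zero to zero. Positively: if [v i] is apart from [0], then by
cotransitivity so is [v i + c i * v k] or [v k]. *)
Lemma pivot_apart m k c (v : 'cV[real]_m) :
  c k ≶ 0 -> vec_apart v (vec0 R m) -> vec_apart (pivot k c v) (vec0 R m).
Proof.
move=> ck0 [i vi0].
suff [j h] : {j & pivot k c v j ord0 ≶ 0} by exists j; rewrite vec0E.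
move: vi0; rewrite vec0E => vi0.
have at_k : v k ord0 ≶ 0 -> {j & pivot k c v j ord0 ≶ 0}.
  by move=> vk0; exists k; rewrite mxE eqxx; exact: apart_mul.
case: (eqVneq i k) => [ik | ik]; first by apply: at_k; rewrite -ik.
case: (apart_add_mul (c i) (v k ord0) vi0) => // h.
by exists i; rewrite mxE (negbTE ik).
Qed.

Lemma xrow_apart m i1 i2 (v : 'cV[real]_m) :
  vec_apart v (vec0 R m) -> vec_apart (xrow i1 i2 v) (vec0 R m).
Proof.
by case=> i h; exists (tperm i1 i2 i); rewrite vec0E !mxE tpermK -(vec0E i).
Qed.

(** The multipliers that turn column [l] into the unit vector number [k]. *)
Definition pivot_coeff m n (A : 'M[real]_(m, n)) k l (p : A k l ≶ 0)
    (i : 'I_m) : real :=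
  if (i == k)%B then CRinv R _ p else - (A i l * CRinv R _ p).

Lemma pivot_coeff_apart m n (A : 'M[real]_(m, n)) k l (p : A k l ≶ 0) :
  pivot_coeff p k ≶ 0.
Proof. by rewrite /pivot_coeff eqxx; exact: apart_inv. Qed.

Lemma pivot_column m n (A : 'M[real]_(m, n)) k l (p : A k l ≶ 0) i :
  pivot k (pivot_coeff p) A i l == kronecker i k.
Proof.
rewrite mxE /pivot_coeff /kronecker eqxx -[(i == k :> nat)%B]/(i == k)%B.
case: eqP => _; first exact: CRinv_l.
have -> : A i l + - (A i l * CRinv R _ p) * A k l ==
  A i l + - (A i l * (CRinv R _ p * A k l)) by ring.
rewrite CRinv_l; ring.
Qed.

(** This is what protects the unit columns produced by earlier steps. *)
Lemma pivot_fixes_column m n (A : 'M[real]_(m, n)) k c j :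
  A k j == 0 -> forall i, pivot k c A i j == A i j.
Proof.
move=> Akj i; rewrite mxE; case: (eqVneq i k) => [-> | _].
  by rewrite Akj CRmult_0_r.
by rewrite Akj CRmult_0_r CRplus_0_r.
Qed.

Definition unit_columns m n (k : nat) (A : 'M[real]_(m, n)) : Prop :=
  forall (i : 'I_m) (j : 'I_n), (j < k)%N -> A i j == kronecker i j.

(** * First round: reducing a basis of the column space *)

Definition independent_columns m r (X : 'M[real]_(m, r)) : Type :=
  forall b : 'cV[real]_r,
    vec_apart b (vec0 R r) -> vec_apart (X ⋅ b) (vec0 R m).

Record column_basis m n r (A : 'M[real]_(m, n)) (X : 'M[real]_(m, r)) : Type :=
  ColumnBasis {
  basis_coords : {Y : 'M[real]_(r, n) & A =m X ⋅ Y};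
  basis_in_span : {Z : 'M[real]_(n, r) & X =m A ⋅ Z};
  basis_independent : independent_columns X
}.

(** The basis vectors are the columns of [X]. Each column of [A] and each basis
vector lies in both spans, and the coordinates there form [Y] and [Z]. *)
Lemma has_rank_column_basis m n r (A : 'M[real]_(m, n)) :
  has_rank A r -> {X : 'M[real]_(m, r) & column_basis A X}.
Proof.
case=> x [ind spans].
pose X : 'M[real]_(m, r) := (\matrix_(i, j) x j i ord0)%R.
have combX b i : lin_comb x b i ord0 == (X ⋅ b) i ord0.
  by rewrite !mxE; apply: sum_eq => j; rewrite mxE CRmult_comm.
have coord l : {b : 'cV[real]_r & forall i, A i l == lin_comb x b i ord0}.
  have [_ /(_ _)] := spans (col l A).
  case=> [|b bA]; last by exists b => i; rewrite -bA mxE.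
  exists (\col_j kronecker j l)%R => i; rewrite mxE [X in _ == X]mxE.
  rewrite (@sum_only _ _ l) => [|j jl].
    by rewrite !mxE /kronecker eqxx CRmult_1_l.
  by rewrite mxE /kronecker -[(j == l :> nat)%B]/(j == l)%B (negbTE jl) CRmult_0_l.
have member j : {b : 'cV[real]_n &
    forall i, x j i ord0 == lin_comb (fun l => col l A) b i ord0}.
  have [/(_ _)] := spans (x j).
  case=> [|b bx _]; last by exists b => i; rewrite -bx.
  exists (\col_k kronecker k j)%R => i.
  rewrite mxE (@sum_only _ _ j) => [|k kj].
    by rewrite !mxE /kronecker eqxx CRmult_1_l.
  by rewrite mxE /kronecker -[(k == j :> nat)%B]/(k == j)%B (negbTE kj) CRmult_0_l.
exists X; split.
- exists (\matrix_(k, l) projT1 (coord l) k ord0)%R => i l.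
  rewrite (projT2 (coord l) i) !mxE.
  by apply: sum_eq => k; rewrite !mxE CRmult_comm.
- exists (\matrix_(l, j) projT1 (member j) l ord0)%R => i j.
  rewrite mxE (projT2 (member j) i) !mxE.
  by apply: sum_eq => l; rewrite !mxE CRmult_comm.
- move=> b /ind [i]; rewrite vec0E => h; exists i; rewrite vec0E.
  exact: apart_eq (combX b i) h.
Qed.

Lemma column_basis_pivot m n r (A : 'M[real]_(m, n)) (X : 'M[real]_(m, r)) k c :
  c k ≶ 0 -> column_basis A X -> column_basis (pivot k c A) (pivot k c X).
Proof.
move=> ck0 [[Y AXY] [Z XAZ] ind]; split.
- exists Y => i j; rewrite (pivot_mul k c X Y i j).
  exact: pivot_eq.
- exists Z => i j; rewrite (pivot_mul k c A Z i j).
  exact: pivot_eq.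
- move=> b /ind /(pivot_apart ck0) [i h]; exists i.
  by rewrite (pivot_mul k c X b i ord0).
Qed.

Lemma column_basis_xrow m n r (A : 'M[real]_(m, n)) (X : 'M[real]_(m, r))
    i1 i2 :
  column_basis A X -> column_basis (xrow i1 i2 A) (xrow i1 i2 X).
Proof.
move=> [[Y AXY] [Z XAZ] ind]; split.
- exists Y => i j; rewrite (xrow_mul i1 i2 X Y i j).
  by rewrite mxE [X in _ == X]mxE.
- exists Z => i j; rewrite (xrow_mul i1 i2 A Z i j).
  by rewrite mxE [X in _ == X]mxE.
- move=> b /ind /(xrow_apart i1 i2) [i h]; exists i.
  by rewrite (xrow_mul i1 i2 X b i ord0).
Qed.

(** Apply independence to the [b] for which [X b] is column [k] of [X] with its
first [k] entries cleared. Some entry of [X b] is apart from [0]; it cannot be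
among the first [k], which are [0]. *)
Lemma independent_pivot m r (X : 'M[real]_(m, r)) (k : 'I_r) :
  independent_columns X -> unit_columns k X ->
  {i : 'I_m & ((k <= i)%N * (X i k ≶ 0))%type}.
Proof.
move=> ind unitX.
(* It is not known yet that [k <= m], so [j < k] may fail to be a row index;
   [X] then has no row where [b_ j] contributes, and the default [0] is
   harmless. *)
pose b_ (j : 'I_r) : real := if (j == k)%B then 1 else
  if (j < k)%N then oapp (fun i : 'I_m => - X i k) 0 (insub (j : nat)) else 0.
pose b : 'cV[real]_r := (\col_j b_ j)%R.
have bk : b k ord0 == 1 by rewrite mxE /b_ eqxx.
have b_gt (j : 'I_r) : (k < j)%N -> b j ord0 == 0.
  move=> kj; rewrite mxE /b_ ltnNge ltnW //=.
  by case: eqVneq kj => [-> | //]; rewrite ltnn.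
have [|i Xbi] := ind b.
  by exists k; rewrite vec0E bk; exact: apart10.
have {}Xbi : \sum_(j < r) (X i j * b j ord0) ≶ 0.
  by move: Xbi; rewrite vec0E mxE.
case: (leqP k i) => [ki | ik].
  case: (sum_apart Xbi) => j h.
  have Xij := apart_mul_l h; have bj := apart_mul_r h.
  case: (ltngtP j k) => [jk | kj | /val_inj jk].
  - exfalso; apply: (apart_zero_absurd _ Xij); rewrite (unitX _ _ jk) /kronecker.
    by case: eqP => // e; move: ki; rewrite e leqNgt jk.
  - by case: (apart_zero_absurd (b_gt _ kj) bj).
  - by exists i; split=> //; rewrite -jk.
have ir : (i < r)%N by exact: ltn_trans ik (ltn_ord k).
pose i' : 'I_r := Ordinal ir.
exfalso; apply: (apart_zero_absurd _ Xbi).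
(* Row [i < k] of [X b] has two contributions, from [j = i] and [j = k],
   which cancel. *)
have split_sum : \sum_(j < r) (X i j * b j ord0) ==
    \sum_(j < r) ((if (j == i')%B then - X i k else 0) +
                  (if (j == k)%B then X i k else 0)).
  apply: sum_eq => j; case: (ltngtP j k) => [jk | kj | /val_inj ->].
  - rewrite (unitX _ _ jk) /kronecker eq_sym -[(j == i :> nat)%B]/(j == i')%B.
    have /negbTE jk' : (j != k)%B by rewrite -val_eqE /= neq_ltn jk.
    rewrite jk'; case: (eqVneq j i') => [ji | _]; last by ring.
    rewrite mxE /b_ jk' jk ji /= (valK i) /=; ring.
  - rewrite (b_gt _ kj).
    have /negbTE -> : (j != i')%B.
      by rewrite -val_eqE /= neq_ltn (ltn_trans ik kj) orbT.
    have /negbTE -> : (j != k)%B by rewrite -val_eqE /= neq_ltn kj orbT.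
    ring.
  - have /negbTE -> : (k != i')%B by rewrite -val_eqE /= neq_ltn ik orbT.
    rewrite eqxx bk; ring.
rewrite split_sum sum_add (@sum_only _ _ i') => [|j /negbTE -> //].
rewrite (@sum_only _ _ k) => [|j /negbTE -> //].
rewrite !eqxx; ring.
Qed.

Lemma unit_columns_pivot m n (A : 'M[real]_(m, n)) (k : 'I_m) (l : 'I_n)
    (p : A k l ≶ 0) :
  (l = k :> nat) -> unit_columns k A ->
  unit_columns k.+1 (pivot k (pivot_coeff p) A).
Proof.
move=> lk unitA i j; rewrite ltnS leq_eqVlt => /orP [/eqP jk | jk].
  have -> : j = l by apply: val_inj; rewrite /= jk lk.
  by rewrite lk; exact: pivot_column.
rewrite pivot_fixes_column; first exact: unitA.
by rewrite (unitA _ _ jk) /kronecker gtn_eqF.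
Qed.

Lemma unit_columns_xrow m n (A : 'M[real]_(m, n)) (k i : 'I_m) :
  (k <= i)%N -> unit_columns k A -> unit_columns k (xrow k i A).
Proof.
move=> ki unitA a j jk; rewrite mxE (unitA _ _ jk) /kronecker.
have ji := leq_trans jk ki.
by case: tpermP => // ->; rewrite !gtn_eqF.
Qed.

Lemma unit_columns_xcol m n (A : 'M[real]_(m, n)) k (l l' : 'I_n) :
  (k <= l)%N -> (k <= l')%N -> unit_columns k A -> unit_columns k (xcol l l' A).
Proof.
move=> kl kl' unitA i j jk; rewrite mxE tpermD; first exact: unitA.
- by rewrite -val_eqE gtn_eqF // (leq_trans jk).
- by rewrite -val_eqE gtn_eqF // (leq_trans jk).
Qed.

(** The bound [k <= m] comes out of the recursion: every pivot found is in a row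
numbered at least [k]. For [k = r] it says that the rank is at most [m]. *)
Lemma reduce_basis m n r (A : 'M[real]_(m, n)) (X : 'M[real]_(m, r)) k :
  (k <= r)%N -> column_basis A X ->
  {A' : 'M[real]_(m, n) & {X' : 'M[real]_(m, r) &
    (transforms A A' * column_basis A' X' * unit_columns k X' *
     (k <= m)%N)%type}}.
Proof.
move=> + basis; elim: k => [_ | k IH kr].
  by exists A, X; split=> //; split=> //; split=> //; exact: TransformsRefl.
have [A1 [X1 [[[tr1 basis1] unit1] km]]] := IH (ltnW kr).
have [i [ki p]] :=
  independent_pivot (k := Ordinal kr) (basis_independent basis1) unit1.
pose k' : 'I_m := Ordinal (leq_ltn_trans ki (ltn_ord i)).
pose X2 := xrow k' i X1.
have p2 : X2 k' (Ordinal kr) ≶ 0 by rewrite mxE tpermL.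
exists (pivot k' (pivot_coeff p2) (xrow k' i A1)).
exists (pivot k' (pivot_coeff p2) X2).
split; last exact: (ltn_ord k').
split; last first.
  apply: (unit_columns_pivot (k := k')) => //.
  exact: (unit_columns_xrow (k := k')).
split; last first.
  apply: column_basis_pivot; first exact: pivot_coeff_apart.
  exact: column_basis_xrow.
apply: transforms_trans tr1 _.
apply: (transforms_trans (transforms_op (RowSwap A1 k' i))).
exact/transforms_pivot/pivot_coeff_apart.
Qed.

(** * Second round: reducing the matrix *)

Definition zero_rows_from m n (r : nat) (A : 'M[real]_(m, n)) : Prop :=
  forall i : 'I_m, (r <= i)%N -> zero_row A i.

(** Surjectivity onto the span of the first [r] unit vectors. It plays the role of
independence of the first [r] rows, in a form that yields pivots directly. *)
Definition onto_first m n (r : nat) (A : 'M[real]_(m, n)) : Type :=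
  forall w : 'cV[real]_m, zero_rows_from r w ->
  {v : 'cV[real]_n & A ⋅ v =m w}.

Lemma unit_basis_zero_rows m n r (A : 'M[real]_(m, n)) (X : 'M[real]_(m, r)) :
  column_basis A X -> unit_columns r X -> zero_rows_from r A.
Proof.
move=> [[Y AXY] _ _] unitX i ri j; rewrite AXY mxE; apply: sum_zero => k.
rewrite (unitX _ _ (ltn_ord k)) /kronecker gtn_eqF ?CRmult_0_l //.
exact: leq_trans ri.
Qed.

(** If [X] is the identity on top of zero and [w] is supported on the first [r]
coordinates, then [w = X u = A (Z u)] with [u] the truncation of [w]. *)
Lemma unit_basis_onto m n r (A : 'M[real]_(m, n)) (X : 'M[real]_(m, r)) :
  (r <= m)%N -> column_basis A X -> unit_columns r X -> onto_first r A.
Proof.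
move=> rm [_ [Z XAZ] _] unitX w w0.
pose u : 'cV[real]_r := (\col_j w (widen_ord rm j) ord0)%R.
exists (Z ⋅ u) => i j; rewrite (ord1 j) -(mat_mul_assoc A Z u i ord0).
rewrite -(mat_mul_eq u XAZ i ord0) mxE.
case: (ltnP i r) => [ir | ri].
  rewrite (@sum_only _ _ (Ordinal ir)) => [|k ki].
    rewrite mxE (unitX _ (Ordinal ir) ir) /kronecker eqxx CRmult_1_l.
    by have -> : widen_ord rm (Ordinal ir) = i by exact: val_inj.
  rewrite (unitX _ _ (ltn_ord k)) /kronecker.
  by rewrite -[(i == k :> nat)%B]/(Ordinal ir == k)%B eq_sym (negbTE ki) CRmult_0_l.
rewrite (w0 i ri ord0) sum_zero // => k.
rewrite (unitX _ _ (ltn_ord k)) /kronecker gtn_eqF ?CRmult_0_l //.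
exact: leq_trans ri.
Qed.

(** To reach [w] after pivoting, reach the preimage of [w] before. That preimage is
again obtained by pivoting, with the inverse multipliers [c']; it has the same
support because the rows from [r] on have multiplier [0]. *)
Lemma onto_first_pivot m n r (A : 'M[real]_(m, n)) (k : 'I_m) c :
  (k < r)%N -> c k ≶ 0 -> (forall i : 'I_m, (r <= i)%N -> c i == 0) ->
  onto_first r A -> onto_first r (pivot k c A).
Proof.
move=> kr ck0 c0 onto w w0.
pose c' (i : 'I_m) : real :=
  if (i == k)%B then CRinv R (c k) ck0 else - (c i * CRinv R (c k) ck0).
have [i ri j | v Av] := onto (pivot k c' w).
  have ik : (i == k)%B = false by rewrite -val_eqE gtn_eqF // (leq_trans kr).
  by rewrite mxE /c' ik (w0 _ ri) (c0 _ ri); ring.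
exists v => i j; rewrite (pivot_mul k c A v i j) (pivot_eq k c Av i j).
rewrite !mxE /c' eqxx; case: eqP => [-> | _].
  rewrite -CRmult_assoc (CRmult_comm (c k)) CRinv_l; exact: CRmult_1_l.
ring.
Qed.

Lemma onto_first_xcol m n r (A : 'M[real]_(m, n)) j1 j2 :
  onto_first r A -> onto_first r (xcol j1 j2 A).
Proof.
move=> onto w /onto [v Av]; exists (xrow j1 j2 v) => i j.
rewrite -Av !mxE -(sum_perm (fun l => A i l * v l j) (tperm j1 j2)).
by apply: sum_eq => l; rewrite !mxE.
Qed.

(** Solving [A v = e_k], row [k] gives a sum equal to [1], so one of its terms is
apart from [0]. *)
Lemma onto_first_pivot_entry m n r (A : 'M[real]_(m, n)) (k : 'I_m) :
  (k < r)%N -> unit_columns k A -> onto_first r A ->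
  {l : 'I_n & ((k <= l)%N * (A k l ≶ 0))%type}.
Proof.
move=> kr unitA onto.
have [i ri j | v Av] := onto (\col_i kronecker i k)%R.
  by rewrite mxE /kronecker gtn_eqF // (leq_trans kr).
have Avk : \sum_(l < n) (A k l * v l ord0) ≶ 0.
  have := Av k ord0; rewrite !mxE /kronecker eqxx => ->; exact: apart10.
have [l /apart_mul_l Akl] := sum_apart Avk; exists l; split=> //.
rewrite leqNgt; apply/negP => lk; apply: (apart_zero_absurd _ Akl).
by rewrite (unitA _ _ lk) /kronecker gtn_eqF.
Qed.

Lemma reduce_rows m n r (A : 'M[real]_(m, n)) k :
  (r <= m)%N -> zero_rows_from r A -> onto_first r A -> (k <= r)%N ->
  {A' : 'M[real]_(m, n) &
    (transforms A A' * zero_rows_from r A' * onto_first r A' *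
     unit_columns k A' * (k <= n)%N)%type}.
Proof.
move=> rm zeroA ontoA; elim: k => [_ | k IH kr].
  by exists A; do 4 split=> //; exact: TransformsRefl.
have [A1 [[[[tr1 zero1] onto1] unit1] kn]] := IH (ltnW kr).
pose k' : 'I_m := Ordinal (leq_trans kr rm).
have [l [kl p]] := onto_first_pivot_entry (k := k') kr unit1 onto1.
pose l' : 'I_n := Ordinal (leq_ltn_trans kl (ltn_ord l)).
pose A2 := xcol l' l A1.
have p2 : A2 k' l' ≶ 0 by rewrite mxE tpermL.
have zero2 : zero_rows_from r A2 by move=> i ri j; rewrite mxE; exact: zero1.
have c0 (i : 'I_m) : (r <= i)%N -> pivot_coeff p2 i == 0.
  move=> ri; rewrite /pivot_coeff.
  have -> : (i == k')%B = false by rewrite -val_eqE gtn_eqF // (leq_trans kr).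
  by rewrite (zero2 _ ri); ring.
exists (pivot k' (pivot_coeff p2) A2).
split; last exact: (ltn_ord l').
split; last first.
  apply: (unit_columns_pivot (k := k')) => //.
  exact: unit_columns_xcol.
split; last first.
  apply: onto_first_pivot => //; first exact: pivot_coeff_apart.
  exact: onto_first_xcol.
split; last first.
  move=> i ri j; rewrite mxE.
  have -> : (i == k')%B = false by rewrite -val_eqE gtn_eqF // (leq_trans kr).
  by rewrite (zero2 _ ri) (c0 _ ri); ring.
apply: transforms_trans tr1 _.
apply: (transforms_trans (transforms_op (ColSwap A1 l' l))).
exact/transforms_pivot/pivot_coeff_apart.
Qed.

(** * The block matrix is in reduced row echelon form *)

Section BlockEchelon.
Variables (m n r : nat) (A : 'M[real]_(m, n)).
Hypotheses (rn : (r <= n)%N) (zeroA : zero_rows_from r A)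
  (unitA : unit_columns r A).

Let unit_diag (i : 'I_m) (ir : (i < r)%N) :
  A i (widen_ord rn (Ordinal ir)) == 1.
Proof. by rewrite unitA // /kronecker eqxx. Qed.

Lemma block_leading (i : 'I_m) (ir : (i < r)%N) :
  leading_at A i (widen_ord rn (Ordinal ir)).
Proof.
split=> [l /= li | ]; last by rewrite unit_diag; exact: apart10.
by rewrite unitA ?(ltn_trans li) // /kronecker gtn_eqF.
Qed.

Lemma block_leading_diag (i : 'I_m) j :
  leading_at A i j -> (j = i :> nat) /\ (i < r)%N.
Proof.
move=> [before Aij]; case: (ltnP i r) => [ir | ri]; last first.
  by case: (apart_zero_absurd (zeroA ri j) Aij).
split=> //; case: (ltngtP j i) => // [ji | ij].
  exfalso; apply: (apart_zero_absurd _ Aij).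
  by rewrite unitA ?(ltn_trans ji) // /kronecker gtn_eqF.
exfalso; apply: (apart_zero_absurd _ apart10).
by rewrite -(unit_diag ir); exact: before.
Qed.

(** Above row [r] the diagonal [1] excludes a zero row and every other leading
position; from row [r] on, no entry can be leading. *)
Lemma block_initial_zeroes (i : 'I_m) k :
  initial_zeroes A i k -> k = if (i < r)%N then i : nat else n.
Proof.
case=> [[j [-> /block_leading_diag [-> ->]]] // | [-> zeroi]].
case: ifP => // ir; exfalso; apply: (apart_zero_absurd _ apart10).
by rewrite -(unit_diag ir); exact: zeroi.
Qed.

Lemma block_reduced : reduced_row_echelon A.
Proof.
split; first split.
- move=> i; case: (ltnP i r) => [ir | ri]; last by right; exact: zeroA.
  by left; exists (widen_ord rn (Ordinal ir)); exact: block_leading.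
- move=> i i' k k' h h'.
  rewrite (block_initial_zeroes h) (block_initial_zeroes h').
  case: (ltnP i r) => [ir | ri]; case: (ltnP i' r) => [i'r | ri'] //.
  + move=> ni; have := ltn_trans ni (leq_trans ir rn).
    by rewrite ltnn.
  + by move=> _; exact: leq_trans ri.
  + by rewrite ltnn.
- move=> i i' k ii' h h'.
  move: (block_initial_zeroes h'); rewrite (block_initial_zeroes h).
  case: (ltnP i r) => [ir | ri]; case: (ltnP i' r) => [i'r | ri'] e.
  + by case/eqP: ii'; exact: val_inj.
  + by move: (leq_trans ir rn); rewrite e ltnn.
  + by move: (leq_trans i'r rn); rewrite -e ltnn.
  + by split; exact: zeroA.
- move=> i j /block_leading_diag [ji ir].
  by rewrite unitA ji // /kronecker eqxx.
- move=> i j /block_leading_diag [ji ir] i' i'i.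
  by rewrite unitA ji // /kronecker ltn_eqF.
Qed.

End BlockEchelon.

End Reals.

Theorem theorem4p14 (R : ConstructiveReals) (m n : nat)
    (A : 'M[CRcarrier R]_(m, n)) :
  ranked A ->
  {B : 'M[CRcarrier R]_(m, n) & (transforms A B * reduced_row_echelon B)%type}.
Proof.
case=> r /has_rank_column_basis [X basisX].
have [A1 [X1 [[[tr1 basis1] unit1] rm]]] := reduce_basis (leqnn r) basisX.
have zero1 := unit_basis_zero_rows basis1 unit1.
have onto1 := unit_basis_onto rm basis1 unit1.
have [B [[[[tr2 zeroB] _] unitB] rn]] := reduce_rows rm zero1 onto1 (leqnn r).
exists B; split; first exact: transforms_trans tr1 tr2.
exact: (block_reduced rn).
Qed.
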